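(* Let $n\ge2$, $M>1/(n-1)$, $J=\{1,\ldots,n\}$, $X=\{c,a_1,\ldots,a_n\}$ (distinct actions), with payoffs $u_j(c)=0$ for all $j$, $u_j(a_i)=1$ if $j=i$ and $u_j(a_i)=-M$ if $j\ne i$. Put $$\bar\alpha=(1/n,\ldots,1/n),\quad \lambda_c=\frac{n}{(n-1)(1+M)}\in(0,1),\quad C_c=\Big\{\alpha\in\Delta^n:\alpha^i\le\frac{M}{1+M}\ \forall i\Big\}.$$ A stationary MPE exists for every $\delta\in(0,1)$ and $\lambda\in(0,1)$. Every pure worldview is absorbing in every stationary MPE. Moreover, for paths $(\alpha_t,x_t)$ starting at $\alpha_0=\bar\alpha$: (i) If $\lambda<\lambda_c$, every stationary MPE selects a pure worldview in one period and remains there: $\alpha_1\in\mathcal P$ and $\alpha_t=\alpha_1$ for all $t\ge1$. (ii) If $\lambda>\lambda_c$, every stationary MPE satisfies $$x_t=c,\qquad \alpha_t\in C_c,\qquad \operatorname{dist}_1(\alpha_t,\mathcal P)\ge\frac{2}{1+M}>0\qquad\text{for all }t\ge0.$$ The same conclusion holds from every initial state $\alpha_0$ in the set $$\mathcal T_\lambda=\Big\{\alpha\in\Delta^n:\max_i\alpha^i<1-\frac{1}{\lambda(1+M)}\Big\},$$ which is nonempty and relatively open in $\Delta^n$. (iii) If $\lambda=\lambda_c$, there exists a stationary MPE whose continuation from $\bar\alpha$ is a pure absorbing worldview, and there exists a stationary MPE whose continuation from $\bar\alpha$ is a mixed (non-pure) absorbing worldview. In particular, $n=3$ and $M=2$ give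 $\lambda_c=1/2$.
   Context: $\Delta^n=\{\alpha\in\mathbb R^n:\alpha^j\ge0,\ \sum_j\alpha^j=1\}$ is the set of worldviews; $\alpha(j)$ is the vertex with weight one on $j$; $\mathcal P=\{\alpha(1),\ldots,\alpha(n)\}$ is the set of pure worldviews. $U(\alpha,x)=\sum_j\alpha^ju_j(x)$, $z^*(\alpha)=\arg\max_{x\in X}U(\alpha,x)$. $\operatorname{dist}_1(\alpha,A)=\inf_{a\in A}\|\alpha-a\|_1$. Parameters $0<\delta<1$, $0<\lambda<1$. A stationary pure strategy is a pair of arbitrary maps $\phi:\Delta^n\to\Delta^n$, $z:\Delta^n\to X$ (no continuity or measurability assumed). With $\phi^k$ the $k$-fold iterate, put $$C_{\phi,z}(\beta;\alpha)=\sum_{k=0}^\infty\delta^k\big[(1-\lambda)U(\phi^k(\beta),z(\phi^k(\beta)))+\lambda U(\alpha,z(\phi^k(\beta)))\big].$$ A stationary MPE is a pair $(\phi,z)$ such that for every $\alpha\in\Delta^n$: $z(\alpha)\in z^*(\alpha)$, and $C_{\phi,z}(\phi(\alpha);\alpha)\ge C_{\phi,z}(\beta;\alpha)$ for every $\beta\in\Delta^n$. The induced path from $\alpha_0$ is $\alpha_{t+1}=\phi(\alpha_t)$, $x_t=z(\alpha_t)$. A worldview $\alpha$ is absorbing under $\phi$ if $\phi(\alpha)=\alpha$. The continuation from $\bar\alpha$ is an absorbing worldview $p$ when $\phi(\bar\alpha)=p$ and $\phi(p)=p$. *)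

(* Defs.v *)
From mathcomp Require Import all_boot all_order all_algebra.
From mathcomp Require Import all_classical all_reals all_analysis.

Set Implicit Arguments.
Unset Strict Implicit.
Unset Printing Implicit Defensive.

Import Order.TTheory GRing.Theory Num.Theory numFieldNormedType.Exports.

Local Open Scope classical_set_scope.
Local Open Scope ring_scope.

Definition simplex (R : realType) (n : nat) : set 'rV[R]_n :=
  [set a | (forall j, 0 <= a 0 j) /\ \sum_j a 0 j = 1].

(* As a [set_type], it carries the topology induced from 'rV[R]_n: [open] on a
   [set (worldview R n)] means relatively open in the simplex. *)
Notation worldview R n := (set_type (@simplex R n)).

Definition weight (R : realType) (n : nat) (a : worldview R n) (j : 'I_n) : R :=
  set_val a 0 j.

Lemma vertex_subproof (R : realType) (n : nat) (j : 'I_n) :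
  (delta_mx 0 j : 'rV[R]_n) \in @simplex R n.
Proof.
apply/mem_set; split=> [i|]; first by rewrite mxE ler0n.
rewrite (bigD1 j) //= mxE !eqxx big1 ?addr0 // => i /negPf ij.
by rewrite mxE ij andbF.
Qed.

Definition vertex (R : realType) (n : nat) (j : 'I_n) : worldview R n :=
  exist _ (delta_mx 0 j) (vertex_subproof R j).

Definition pure_worldviews (R : realType) (n : nat) : set (worldview R n) :=
  range (@vertex R n).

Lemma barycenter_subproof (R : realType) (n : nat) (n_gt0 : (0 < n)%N) :
  (const_mx n%:R^-1 : 'rV[R]_n) \in @simplex R n.
Proof.
apply/mem_set; split=> [i|]; first by rewrite mxE invr_ge0 ler0n.
under eq_bigr do rewrite mxE.
by rewrite sumr_const card_ord -[_ *+ n]mulr_natr mulVf // pnatr_eq0 -lt0n.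
Qed.

Definition barycenter (R : realType) (n : nat) (n_gt0 : (0 < n)%N) :
    worldview R n :=
  exist _ (const_mx n%:R^-1) (barycenter_subproof R n_gt0).

Definition l1_dist (R : realType) (n : nat) (a b : worldview R n) : R :=
  \sum_j `|weight a j - weight b j|.

(* The infimum of the empty set is 0; only used with A nonempty. *)
Definition dist1 (R : realType) (n : nat) (a : worldview R n)
    (A : set (worldview R n)) : R :=
  inf [set l1_dist a b | b in A].

Definition payoff (R : realType) (n : nat) (X : Type) (u : 'I_n -> X -> R)
    (a : worldview R n) (x : X) : R :=
  \sum_j weight a j * u j x.

Definition best_actions (R : realType) (n : nat) (X : Type)
    (u : 'I_n -> X -> R) (a : worldview R n) : set X :=
  [set x | forall y, payoff u a y <= payoff u a x].

(* The limit exists whenever u is bounded and 0 < delta < 1. *)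
Definition continuation_value (R : realType) (n : nat) (X : Type)
    (u : 'I_n -> X -> R) (delta lambda : R)
    (phi : worldview R n -> worldview R n) (z : worldview R n -> X)
    (b a : worldview R n) : R :=
  limn (series (fun k : nat =>
    let bk := iter k phi b in
    delta ^+ k *
      ((1 - lambda) * payoff u bk (z bk) + lambda * payoff u a (z bk)))).

Definition stationary_MPE (R : realType) (n : nat) (X : Type)
    (u : 'I_n -> X -> R) (delta lambda : R)
    (phi : worldview R n -> worldview R n) (z : worldview R n -> X) : Prop :=
  forall a : worldview R n,
    best_actions u a (z a) /\
    forall b : worldview R n,
      continuation_value u delta lambda phi z b a <=
      continuation_value u delta lambda phi z (phi a) a.

Definition worldview_path (R : realType) (n : nat)
    (phi : worldview R n -> worldview R n) (a0 : worldview R n) (t : nat) :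
    worldview R n :=
  iter t phi a0.

Definition action_path (R : realType) (n : nat) (X : Type)
    (phi : worldview R n -> worldview R n) (z : worldview R n -> X)
    (a0 : worldview R n) (t : nat) : X :=
  z (worldview_path phi a0 t).

Definition absorbing (R : realType) (n : nat)
    (phi : worldview R n -> worldview R n) (a : worldview R n) : Prop :=
  phi a = a.

Definition absorbing_continuation (R : realType) (n : nat)
    (phi : worldview R n -> worldview R n) (a p : worldview R n) : Prop :=
  phi a = p /\ absorbing phi p.

Inductive action (n : nat) : Type :=
| compromise : action n
| favor : 'I_n -> action n.
Arguments compromise {n}.

Definition utility (R : realType) (n : nat) (M : R) (j : 'I_n)
    (x : action n) : R :=
  match x with
  | compromise => 0
  | favor i => if j == i then 1 else - M
  end.

Definition lambda_c (R : realType) (n : nat) (M : R) : R :=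
  n%:R / ((n%:R - 1) * (1 + M)).

Definition compromise_set (R : realType) (n : nat) (M : R) :
    set (worldview R n) :=
  [set a | forall i, weight a i <= M / (1 + M)].

(* Weights are nonnegative, so the default 0 does not affect the maximum
   when n > 0. *)
Definition trap_set (R : realType) (n : nat) (M lambda : R) :
    set (worldview R n) :=
  [set a | \big[Num.max/0]_i weight a i < 1 - 1 / (lambda * (1 + M))].

Definition compromise_path (R : realType) (n : nat) (M : R)
    (phi : worldview R n -> worldview R n) (z : worldview R n -> action n)
    (a0 : worldview R n) : Prop :=
  forall t : nat,
    [/\ action_path phi z a0 t = compromise,
        compromise_set M (worldview_path phi a0 t) &
        2 / (1 + M) <= dist1 (worldview_path phi a0 t) (@pure_worldviews R n)].

(* Main.v *)
Require Import Defs.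
From mathcomp Require Import all_boot all_order all_algebra.
From mathcomp Require Import all_classical all_reals all_analysis.
From mathcomp Require Import ring lra.

Set Implicit Arguments.
Unset Strict Implicit.
Unset Printing Implicit Defensive.

Import Order.TTheory GRing.Theory Num.Theory numFieldNormedType.Exports.

Local Open Scope classical_set_scope.
Local Open Scope ring_scope.

(* Occupying [vertex i] forever gives a sitting worldview [a] the flow value
   g_i(a) = 1 - lambda (1 + M) (1 - a^i), while compromise gives 0, and no
   occupied worldview ever gives more than max(0, max_i g_i(a)). Hence an optimal
   continuation attains this maximum in every period as soon as its total value
   is at least the maximum forever, which pins down its path: it is pure when
   some g_i(a) > 0, and compromises forever when all g_i(a) < 0. At the
   barycenter every g_i has the sign of lambda_c - lambda. Equilibria are obtained
   by jumping to the vertex of largest weight, or to the barycenter when no g_i(a)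
   is positive. *)

(** * Discounted sums of bounded streams *)

Section discounted_sums.
Variables (R : realType) (delta : R).
Hypothesis (d01 : 0 < delta < 1).
Implicit Types s : nat -> R.

Definition discounted s : R := limn (series (fun k => delta ^+ k * s k)).

Let d0 : 0 <= delta. Proof. by case/andP: d01 => /ltW. Qed.

Let normd : `|delta| < 1. Proof. by rewrite ger0_norm //; case/andP: d01. Qed.

Lemma is_cvg_discounted s (B : R) :
  (forall k, `|s k| <= B) -> cvgn (series (fun k => delta ^+ k * s k)).
Proof.
move=> sB; apply: normed_cvg.
have B0 : 0 <= B := le_trans (normr_ge0 (s 0)) (sB 0%N).
apply: (series_le_cvg _ _ _ (is_cvg_geometric_series (a := B) normd)) => k //=.
  by rewrite mulr_ge0 // exprn_ge0.
by rewrite normrM ger0_norm ?exprn_ge0 // mulrC ler_wpM2r ?exprn_ge0.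
Qed.

Lemma discounted_cst (m : R) : discounted (fun=> m) = m / (1 - delta).
Proof.
apply/cvg_lim => //; rewrite (_ : (fun k => _) = geometric m delta).
  exact: cvg_geometric_series.
by apply/funext => k; rewrite mulrC.
Qed.

Lemma discountedS s (B : R) : (forall k, `|s k| <= B) ->
  discounted s = s 0%N + delta * discounted (fun k => s k.+1).
Proof.
move=> sB; apply/cvg_lim => //.
have cS : cvgn (series (fun k => delta ^+ k * s k.+1)).
  by apply: (@is_cvg_discounted _ B) => k.
rewrite -cvg_shiftS.
rewrite (_ : (fun n => _) = (fun n => s 0%N + delta *
    series (fun k => delta ^+ k * s k.+1) n)).
  apply: cvgD; first exact: cvg_cst.
  by apply: cvgM; [exact: cvg_cst|exact: cS].
apply/funext => n; rewrite /series /= big_nat_recl // expr0 mul1r; congr (_ + _).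
by rewrite mulr_sumr; apply: eq_bigr => i _; rewrite exprS mulrA.
Qed.

Lemma discounted_le s (B m : R) : (forall k, `|s k| <= B) ->
  (forall k, s k <= m) -> discounted s <= m / (1 - delta).
Proof.
move=> sB sm; rewrite -discounted_cst; apply: lim_series_le.
- exact: is_cvg_discounted sB.
- exact: (@is_cvg_discounted _ `|m|).
- by move=> k; rewrite ler_wpM2l ?exprn_ge0.
Qed.

(** A tail is worth at most [m / (1 - delta)], so the first term cannot fall below [m]; as it cannot
    exceed [m] either, the tail inherits the lower bound and the induction passes to it. *)
Lemma discounted_max s (B m : R) : (forall k, `|s k| <= B) ->
  (forall k, s k <= m) -> m / (1 - delta) <= discounted s ->
  forall k, s k = m.
Proof.
move=> sB sm + k; elim: k s sB sm => [|k IH] s sB sm.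
  rewrite (discountedS sB) => h; apply/le_anti; rewrite sm /=.
  have := discounted_le (fun k => sB k.+1) (fun k => sm k.+1).
  have [dp d1] := andP d01.
  move=> /(ler_wpM2l d0) h2.
  have -> : m = m / (1 - delta) - delta * (m / (1 - delta)) by field; lra.
  lra.
rewrite (discountedS sB) => h; apply: (IH (fun k => s k.+1)) => //.
have [dp d1] := andP d01.
have s0 := sm 0%N.
rewrite -(ler_pM2l dp).
have : m = m / (1 - delta) - delta * (m / (1 - delta)) by field; lra.
lra.
Qed.

End discounted_sums.

(** * Stationary equilibria for a bounded utility *)

Section equilibria.
Variables (R : realType) (n : nat) (X : Type) (u : 'I_n -> X -> R) (B : R).
Hypothesis u_bounded : forall j x, `|u j x| <= B.
Variables (delta lambda : R).
Hypotheses (d01 : 0 < delta < 1).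
Implicit Types (a b : worldview R n) (phi : worldview R n -> worldview R n)
  (z : worldview R n -> X).

Lemma weight_ge0 a j : 0 <= weight a j.
Proof. by have [+ _] : simplex (set_val a) := set_valP a; exact. Qed.

Lemma sum_weight a : \sum_j weight a j = 1.
Proof. by have [_] : simplex (set_val a) := set_valP a. Qed.

Lemma weight_le1 a j : weight a j <= 1.
Proof.
rewrite -(sum_weight a) (bigD1 j) //= lerDl.
by apply: sumr_ge0 => i _; exact: weight_ge0.
Qed.

Lemma payoff_bounded a x : `|payoff u a x| <= B.
Proof.
apply: (le_trans (ler_norm_sum _ _ _)).
rewrite -[leRHS]mul1r -(sum_weight a) mulr_suml; apply: ler_sum => j _.
by rewrite normrM (ger0_norm (weight_ge0 a j)) ler_wpM2l ?weight_ge0.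
Qed.

Definition stage_value z b a : R :=
  (1 - lambda) * payoff u b (z b) + lambda * payoff u a (z b).

Lemma stage_value_bounded z b a :
  `|stage_value z b a| <= `|1 - lambda| * B + `|lambda| * B.
Proof.
apply: (le_trans (ler_normD _ _)).
by rewrite !normrM lerD // ler_wpM2l ?payoff_bounded.
Qed.

Lemma continuation_valueE phi z b a :
  continuation_value u delta lambda phi z b a =
  discounted delta (fun k => stage_value z (iter k phi b) a).
Proof. by []. Qed.

Lemma continuation_value_absorbing phi z b a : phi b = b ->
  continuation_value u delta lambda phi z b a = stage_value z b a / (1 - delta).
Proof.
move=> pb; rewrite continuation_valueE -discounted_cst //; congr discounted.
by apply/funext => k; congr stage_value; elim: k => //= k ->.
Qed.

(* Staying at [a] for one period delays the optimal continuation by one period,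
   so an optimal continuation is worth at least the current stage forever. *)
Lemma MPE_value_ge_stay phi z : stationary_MPE u delta lambda phi z ->
  forall a, stage_value z a a / (1 - delta) <=
  continuation_value u delta lambda phi z (phi a) a.
Proof.
move=> mpe a; have := (mpe a).2 a; rewrite !continuation_valueE.
rewrite (discountedS d01 (fun k => stage_value_bounded z (iter k phi a) a)).
have [dp d1] := andP d01.
rewrite ler_pdivrMr ?subr_gt0 //.
(* From the second period on, the path from [a] is the path from [phi a], so its value is the
   current stage plus [delta] times the optimal value. *)
under [fun k => stage_value _ (iter k.+1 _ _) _]funext => k do rewrite iterSr.
by rewrite /=; lra.
Qed.

Lemma MPE_stage_max phi z a m :
  (forall b, stage_value z b a <= m) ->
  m / (1 - delta) <= continuation_value u delta lambda phi z (phi a) a ->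
  forall k, stage_value z (iter k phi (phi a)) a = m.
Proof.
move=> sm h.
by apply: (discounted_max d01 (fun k => stage_value_bounded _ _ _) _ h) => k.
Qed.

(** The chosen path is constant after one step, so a single best stage suffices: a deviation may
    wander, but each of its stages is bounded by that one. *)
Lemma idempotent_MPE phi z :
  (forall a, best_actions u a (z a)) -> (forall a, phi (phi a) = phi a) ->
  (forall a b, stage_value z b a <= stage_value z (phi a) a) ->
  stationary_MPE u delta lambda phi z.
Proof.
move=> zbest phiK sm a; split=> // b.
rewrite (continuation_value_absorbing z a (phiK a)) continuation_valueE.
apply: (discounted_le d01 (fun k => stage_value_bounded _ _ _)) => k.
exact: sm.
Qed.

End equilibria.

(** * Vertices, largest weights and open sets of the simplex *)

Section worldviews.
Variables (R : realType) (n : nat).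
Implicit Types (a b : worldview R n) (i j : 'I_n).

Lemma weight_vertex j i : weight (vertex R j) i = (i == j)%:R.
Proof. by rewrite /weight set_valE /= mxE. Qed.

Lemma weight_barycenter (n_gt0 : (0 < n)%N) i :
  weight (barycenter R n_gt0) i = n%:R^-1.
Proof. by rewrite /weight set_valE /= mxE. Qed.

Lemma vertex_pure j : pure_worldviews (vertex R j).
Proof. by exists j. Qed.

Lemma weight_eq1 a j : weight a j = 1 -> a = vertex R j.
Proof.
move=> aj1; apply/val_inj/rowP => i.
rewrite -[LHS]/(weight a i) -[RHS]/(weight (vertex R j) i) weight_vertex.
case: eqVneq => [->//|ij].
have := sum_weight a; rewrite (bigD1 j) //= aj1 => /(canRL (addKr _)).
rewrite addNr => /eqP.
by rewrite psumr_eq0 => [/allP/(_ i (mem_index_enum _))|k _];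
  rewrite ?ij ?weight_ge0 // => /eqP.
Qed.

(** The mass missing at [j] counts once at [j] and once over the other indices. *)
Lemma l1_dist_vertex a j : l1_dist a (vertex R j) = 2 * (1 - weight a j).
Proof.
have sa := sum_weight a; rewrite (bigD1 j) //= in sa.
rewrite /l1_dist (bigD1 j) //=.
rewrite weight_vertex eqxx distrC ger0_norm ?subr_ge0 ?weight_le1 //.
rewrite (eq_bigr (weight a)) => [|i /negPf ij]; first by rewrite /=; lra.
by rewrite weight_vertex ij subr0 ger0_norm ?weight_ge0.
Qed.

Definition favorite (i0 : 'I_n) a : 'I_n := [arg max_(i > i0) weight a i]%O.

Lemma weight_le_favorite i0 a i : weight a i <= weight a (favorite i0 a).
Proof. by rewrite /favorite; case: arg_maxP => // j _; exact. Qed.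

Lemma favorite_vertex i0 j : favorite i0 (vertex R j) = j.
Proof.
apply/eqP; have := weight_le_favorite i0 (vertex R j) j.
by rewrite !weight_vertex eqxx; case: eqP => //; rewrite ler10.
Qed.

Lemma weight_favorite_ge i0 a : n%:R^-1 <= weight a (favorite i0 a).
Proof.
have n0 : (0 < n)%N := leq_ltn_trans (leq0n i0) (ltn_ord i0).
rewrite -[leLHS]mulr1 ler_pdivrMl ?ltr0n // -[leLHS](sum_weight a).
rewrite mulr_natl -[n in _ *+ n]card_ord -sumr_const.
by apply: ler_sum => i _; exact: weight_le_favorite.
Qed.

(** The bound amounts to [0 < t], from the default value, and finitely many open conditions on
    coordinates. *)
Lemma open_bigmax_weight (t : R) :
  open [set a : worldview R n | \big[Num.max/0]_i weight a i < t].
Proof.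
rewrite openE => a /bigmax_ltP[t0 at_].
have : \forall b \near a, forall i, weight b i < t.
  apply: (@filter_forall _ _ (fun i b => weight b i < t) (nbhs a)) => i.
  apply: open_nbhs_nbhs; split; last exact: at_.
  apply: (@open_comp _ _ (fun b => weight b i) [set x | x < t]);
    last exact: open_lt.
  move=> b _; apply: (@continuous_comp _ _ _ set_val (fun v : 'rV[R]_n => v 0 i)).
    exact: (@initial_continuous (worldview R n) _ set_val).
  exact: (@coord_continuous _ 1 n 0 i).
by apply: filterS => b bt; apply/bigmax_ltP.
Qed.

End worldviews.

(** * Equilibrium paths in the compromise game *)

Section compromise.
Variables (R : realType) (n : nat) (M : R) (delta lambda : R).
Hypotheses (M0 : 0 < M) (d01 : 0 < delta < 1) (l01 : 0 < lambda < 1).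
Implicit Types (a b : worldview R n) (i j : 'I_n)
  (phi : worldview R n -> worldview R n) (z : worldview R n -> action n).
Let u : 'I_n -> action n -> R := @utility R n M.

Let M1 : 0 < 1 + M. Proof. by rewrite addr_gt0. Qed.
Let l0 : 0 < lambda. Proof. by case/andP: l01. Qed.
Let l1 : 0 < 1 - lambda. Proof. by rewrite subr_gt0; case/andP: l01. Qed.

Lemma utility_bounded j x : `|u j x| <= 1 + M.
Proof.
case: x => [|i]; rewrite /u /= ?normr0; first exact: ltW.
case: eqP => _; first by rewrite normr1 lerDl ltW.
by rewrite normrN ger0_norm ?ltW // ltrDr.
Qed.

Lemma payoff_compromise a : payoff u a compromise = 0.
Proof. by rewrite /payoff big1 // => j _; rewrite mulr0. Qed.

Lemma payoff_favor a i : payoff u a (favor i) = (1 + M) * weight a i - M.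
Proof.
have sa := sum_weight a; rewrite (bigD1 i) //= in sa.
rewrite /payoff (bigD1 i) //= eqxx.
rewrite (eq_bigr (fun j => weight a j * - M)) => [|j /negPf -> //].
rewrite -mulr_suml.
have -> : \sum_(j < n | j != i) weight a j = 1 - weight a i by lra.
by ring.
Qed.

(* Flow value to a sitting worldview [a] of being [vertex i] forever. *)
Definition pure_gain a i : R := 1 - lambda * (1 + M) * (1 - weight a i).

Lemma stage_compromise z a b : z b = compromise ->
  stage_value u lambda z b a = 0.
Proof. by rewrite /stage_value => ->; rewrite !payoff_compromise !mulr0 addr0. Qed.

Lemma stage_favor z a b i : z b = favor i ->
  stage_value u lambda z b a =
  pure_gain a i - (1 - lambda) * (1 + M) * (1 - weight b i).
Proof. by rewrite /stage_value => ->; rewrite !payoff_favor /pure_gain; ring. Qed.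

(** The shortfall [1 - weight b i] is penalized with a positive factor because [lambda < 1]; the
    equality case is what later forces paths to be pure. *)
Lemma stage_favor_le z a b i : z b = favor i ->
  stage_value u lambda z b a <= pure_gain a i ?= iff (weight b i == 1).
Proof.
move=> /stage_favor ->.
have w1 := weight_le1 b i.
have k0 : 0 < (1 - lambda) * (1 + M) by rewrite mulr_gt0.
apply/leifP; case: eqVneq => [->|w]; first by rewrite subrr mulr0 subr0.
by rewrite ltrBlDr ltrDl mulr_gt0 // subr_gt0 lt_neqAle w.
Qed.

Lemma stage_le z a b m : 0 <= m -> (forall i, pure_gain a i <= m) ->
  stage_value u lambda z b a <= m.
Proof.
move=> m0 gm; case zb : (z b) => [|i]; first by rewrite stage_compromise.
exact: le_trans (stage_favor_le _ zb) (gm i).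
Qed.

Lemma best_action_compromise a : best_actions u a compromise <->
  compromise_set M a.
Proof.
split=> [h i|h [|i]]; rewrite ?payoff_compromise //.
  have := h (favor i); rewrite payoff_compromise payoff_favor.
  by rewrite ler_pdivlMr //; lra.
by rewrite payoff_favor; have := h i; rewrite ler_pdivlMr //; lra.
Qed.

Lemma best_action_vertex j x : best_actions u (vertex R j) x -> x = favor j.
Proof.
move=> /(_ (favor j)); rewrite payoff_favor weight_vertex eqxx mulr1.
case: x => [|i]; rewrite ?payoff_compromise ?payoff_favor.
  by move=> ?; exfalso; lra.
rewrite weight_vertex; case: (i =P j) => [->//|_] /= ?; exfalso.
by have := M0; lra.
Qed.

Lemma pure_gain_le1 a i : pure_gain a i <= 1 ?= iff (weight a i == 1).
Proof.
have w1 := weight_le1 a i.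
have k0 : 0 < lambda * (1 + M) by rewrite mulr_gt0.
rewrite /pure_gain; apply/leifP; case: eqVneq => [->|w].
  by rewrite subrr mulr0 subr0.
by rewrite ltrBlDr ltrDl mulr_gt0 // subr_gt0 lt_neqAle w.
Qed.

(** A positive [m] rules out compromise, which is worth 0; then the bounds of the stage by the gain
    and of the gain by [m] are both tight, and the first is tight only at a vertex. *)
Lemma stage_eq_max z a b m : 0 < m -> (forall i, pure_gain a i <= m) ->
  stage_value u lambda z b a = m ->
  exists2 i, b = vertex R i & pure_gain a i = m.
Proof.
move=> m0 gm; case zb : (z b) => [|i].
  by rewrite stage_compromise // => m0'; rewrite -m0' ltxx in m0.
move=> sm; have h := stage_favor_le a zb.
have e : pure_gain a i = m.
  by apply/le_anti; rewrite gm -[leLHS]sm h.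
exists i => //; apply/weight_eq1/eqP; rewrite -h.2 sm e; exact/eqP.
Qed.

Lemma MPE_value_ge_stage phi z a b : stationary_MPE u delta lambda phi z ->
  phi b = b -> stage_value u lambda z b a / (1 - delta) <=
  continuation_value u delta lambda phi z (phi a) a.
Proof.
move=> mpe pb; rewrite -(continuation_value_absorbing u lambda d01 z a pb).
by have [_] := mpe a; exact.
Qed.

(** Seen from [vertex R j], no stage exceeds 1 and staying gives 1 forever. So [phi (vertex R j)]
    must attain 1 at once, which only [vertex R j] does. *)
Lemma MPE_vertex_absorbing phi z j : stationary_MPE u delta lambda phi z ->
  phi (vertex R j) = vertex R j.
Proof.
move=> mpe; have [zj _] := mpe (vertex R j).
have g1 i : pure_gain (vertex R j) i <= 1 by rewrite pure_gain_le1.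
have s1 : stage_value u lambda z (vertex R j) (vertex R j) = 1.
  rewrite (stage_favor _ (best_action_vertex zj)) /pure_gain.
  by rewrite weight_vertex eqxx subrr !mulr0 !subr0.
have := MPE_value_ge_stay utility_bounded d01 mpe (vertex R j).
have sle b : stage_value u lambda z b (vertex R j) <= 1 by exact: stage_le.
rewrite s1 => /(MPE_stage_max utility_bounded d01 sle)/(_ 0%N).
move=> /(stage_eq_max ltr01 g1)[i /= -> gi]; congr vertex.
have := (pure_gain_le1 (vertex R j) i).2; rewrite gi eqxx weight_vertex.
by case: (eqVneq i j) => // _; rewrite eq_sym oner_eq0.
Qed.

(** The best vertex is absorbing, so jumping to it gives the ceiling [pure_gain a i] in every
    period, and the actual first stage must match it. *)
Lemma MPE_moves_pure phi z a i :
  stationary_MPE u delta lambda phi z -> 0 < pure_gain a i ->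
  (forall j, pure_gain a j <= pure_gain a i) ->
  pure_worldviews (phi a).
Proof.
move=> mpe g0 gmax.
have pi := MPE_vertex_absorbing i mpe.
have := MPE_value_ge_stage a mpe pi; have [zi _] := mpe (vertex R i).
rewrite (stage_favor _ (best_action_vertex zi)) weight_vertex eqxx subrr mulr0 subr0.
have sle b := stage_le z b (ltW g0) gmax.
move=> /(MPE_stage_max utility_bounded d01 sle)/(_ 0%N).
by move=> /(stage_eq_max g0 gmax)[j /= -> _]; exists j.
Qed.

Lemma pure_gain_lt0 a i :
  (pure_gain a i < 0) = (weight a i < 1 - 1 / (lambda * (1 + M))).
Proof.
have k0 : 0 < lambda * (1 + M) by rewrite mulr_gt0.
rewrite ltrBrDl -ltrBrDr ltr_pdivrMr // /pure_gain subr_lt0.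
by rewrite [in RHS]mulrC.
Qed.

(** Conversely, the default value 0 of the maximum demands a positive threshold; a nonnegative
    weight below the threshold provides it. *)
Lemma trap_setP (n_gt0 : (0 < n)%N) a :
  trap_set M lambda a <-> forall i, pure_gain a i < 0.
Proof.
split=> [/bigmax_ltP[_ h] i|h]; first by rewrite pure_gain_lt0 h.
have h' i := etrans (esym (pure_gain_lt0 a i)) (h i).
apply/bigmax_ltP; split=> // [|i _]; last exact: h'.
exact: le_lt_trans (weight_ge0 a (Ordinal n_gt0)) (h' _).
Qed.

Lemma dist1_pure_ge a : (0 < n)%N -> compromise_set M a ->
  2 / (1 + M) <= dist1 a (@pure_worldviews R n).
Proof.
move=> n_gt0 Ca; apply: lb_le_inf.
  apply: image_nonempty; exists (vertex R (Ordinal n_gt0)); exact: vertex_pure.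
move=> _ [_ [j _ <-] <-]; rewrite l1_dist_vertex.
have := Ca j; rewrite ler_pdivlMr // ler_pdivrMr //; lra.
Qed.

(** Staying at [a] means compromise, worth 0, while every [favor] stage is negative for [a]. The
    optimal path thus has stage value 0 in every period, hence always compromises. *)
Lemma MPE_trapped phi z a : (0 < n)%N ->
  stationary_MPE u delta lambda phi z -> trap_set M lambda a ->
  compromise_path M phi z a.
Proof.
move=> n_gt0 mpe /(trap_setP n_gt0) g0.
suff zc t : z (iter t phi a) = compromise.
  move=> t; have Ct : compromise_set M (iter t phi a).
    by apply/best_action_compromise; rewrite -(zc t); have [] := mpe (iter t phi a).
  by split=> //; [exact: zc|exact: dist1_pure_ge].
have neg b i : z b = favor i -> stage_value u lambda z b a < 0.
  by move=> /(stage_favor_le a) h; exact: le_lt_trans h (g0 i).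
have za : z a = compromise.
  case za : (z a) => [//|i]; have [+ _] := mpe a; rewrite za => /(_ compromise).
  rewrite payoff_compromise payoff_favor => wi.
  (* Optimality of [favor i] at [a] gives [(1 + M) * (1 - weight a i) <= 1], and with [lambda < 1]
     the gain would be nonnegative. *)
  exfalso; have := g0 i; rewrite /pure_gain.
  have w1 := weight_le1 a i.
  have : lambda * ((1 + M) * (1 - weight a i)) <= (1 + M) * (1 - weight a i).
    rewrite ler_piMl ?mulr_ge0 ?subr_ge0 ?(ltW M1) //.
    by apply: ltW; rewrite -subr_gt0.
  have := M0; lra.
case: t => [//|t]; rewrite iterSr.
case zt : (z (iter t phi (phi a))) => [//|i].
have := MPE_value_ge_stay utility_bounded d01 mpe a.
rewrite stage_compromise //.
have sle b : stage_value u lambda z b a <= 0 by apply: stage_le => // j; exact: ltW.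
move=> /(MPE_stage_max utility_bounded d01 sle)/(_ t) s0.
by have := neg _ _ zt; rewrite s0 ltxx.
Qed.

(** * Construction of two families of equilibria *)

Variable i0 : 'I_n.

(** Ties go to compromise, which is thus chosen on all of [compromise_set M], boundary included. *)
Definition favorite_action a : action n :=
  if weight a (favorite i0 a) <= M / (1 + M) then compromise
  else favor (favorite i0 a).

Lemma favorite_action_best a : best_actions u a (favorite_action a).
Proof.
rewrite /favorite_action; case: ifPn => [le|].
  apply/best_action_compromise => i.
  exact: le_trans (weight_le_favorite i0 a i) le.
rewrite -ltNge ltr_pdivrMr // => lt [|i].
  by rewrite payoff_compromise payoff_favor; lra.
by rewrite !payoff_favor lerD2r ler_wpM2l ?(ltW M1) // weight_le_favorite.
Qed.

Lemma favorite_action_vertex j : favorite_action (vertex R j) = favor j.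
Proof. exact: best_action_vertex (favorite_action_best _). Qed.

Lemma stage_vertex a j :
  stage_value u lambda favorite_action (vertex R j) a = pure_gain a j.
Proof.
rewrite (stage_favor _ (favorite_action_vertex j)).
by rewrite weight_vertex eqxx subrr mulr0 subr0.
Qed.

Lemma pure_gain_le_favorite a i : pure_gain a i <= pure_gain a (favorite i0 a).
Proof.
rewrite /pure_gain lerD2l lerN2 ler_wpM2l ?mulr_ge0 ?(ltW l0) ?(ltW M1) //.
by rewrite lerD2l lerN2 weight_le_favorite.
Qed.

(** The sign condition makes the best vertex at least as good as compromise for every worldview. *)
Lemma moving_MPE : (forall a, 0 <= pure_gain a (favorite i0 a)) ->
  stationary_MPE u delta lambda (fun a => vertex R (favorite i0 a))
    favorite_action.
Proof.
move=> g0; apply: (idempotent_MPE utility_bounded d01) => [a|a|a b].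
- exact: favorite_action_best.
- by rewrite favorite_vertex.
- rewrite stage_vertex; apply: stage_le => // i; exact: pure_gain_le_favorite.
Qed.

(** The strict test makes the map idempotent: a vertex has favorite gain 1 and is kept, while [c]
    has gain at most 0 and goes to itself. Settling at [c] is worth 0, the most possible when no
    gain is positive. *)
Lemma settling_MPE c : compromise_set M c -> pure_gain c (favorite i0 c) <= 0 ->
  stationary_MPE u delta lambda
    (fun a => if 0 < pure_gain a (favorite i0 a)
              then vertex R (favorite i0 a) else c)
    favorite_action.
Proof.
move=> Cc gc; have zc : favorite_action c = compromise.
  by rewrite /favorite_action Cc.
apply: (idempotent_MPE utility_bounded d01) => [a|a|a b].
- exact: favorite_action_best.
- case: (boolP (0 < pure_gain a (favorite i0 a))) => _; last by rewrite ltNge gc.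
  rewrite favorite_vertex /pure_gain weight_vertex eqxx subrr mulr0 subr0.
  by rewrite ltr01.
- case: ifPn => [g0|]; last rewrite -leNgt => g0.
    rewrite stage_vertex; apply: stage_le => [|i]; first exact: ltW.
    exact: pure_gain_le_favorite.
  rewrite (stage_compromise _ zc); apply: stage_le => // i.
  exact: le_trans (pure_gain_le_favorite _ _) g0.
Qed.

End compromise.

(** * The barycenter and the critical value [lambda_c] *)

Section barycenter.
Variables (R : realType) (n : nat) (n_gt1 : (1 < n)%N) (M : R).
Hypothesis HM : 1 / (n%:R - 1) < M.
Let abar := barycenter R (ltnW n_gt1).

Let n1 : 0 < n%:R - 1 :> R. Proof. by rewrite subr_gt0 ltr1n. Qed.
Let n0 : 0 < n%:R :> R. Proof. by rewrite ltr0n ltnW. Qed.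

Lemma M_gt0 : 0 < M.
Proof. by apply: lt_trans HM; rewrite divr_gt0. Qed.

Let M1 : 0 < 1 + M. Proof. by rewrite addr_gt0 ?M_gt0. Qed.

(** This form of the bound on [M] gives both [lambda_c n M < 1] and the optimality of compromise at
    the barycenter. *)
Lemma nM_gt : n%:R < (n%:R - 1) * (1 + M).
Proof. by move: HM; rewrite ltr_pdivrMr //; lra. Qed.

Lemma lambda_c_bounds : 0 < lambda_c n M < 1.
Proof.
rewrite /lambda_c divr_gt0 ?mulr_gt0 //= ltr_pdivrMr ?mulr_gt0 // mul1r.
exact: nM_gt.
Qed.

Lemma barycenter_compromise : compromise_set M abar.
Proof.
move=> i; rewrite weight_barycenter ler_pdivlMr // ler_pdivrMl //.
have := nM_gt; lra.
Qed.

(** The inverse of [lambda_c n M] is [(1 + M) * (1 - 1 / n)]. *)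
Lemma pure_gain_uniform (lambda : R) (a : worldview R n) i :
  weight a i = n%:R^-1 ->
  pure_gain M lambda a i = (lambda_c n M - lambda) / lambda_c n M.
Proof.
rewrite /pure_gain /lambda_c => ->; field.
by rewrite !gt_eqF.
Qed.

Lemma barycenter_not_pure : ~ pure_worldviews abar.
Proof.
case=> j _ e; have := weight_barycenter R (ltnW n_gt1) j.
rewrite -/abar -e weight_vertex eqxx => /esym/eqP.
by rewrite invr_eq1 pnatr_eq1 gtn_eqF.
Qed.

End barycenter.

Theorem theorem2 (R : realType) :
  (forall (n : nat) (hn : (1 < n)%N) (M : R), 1 / (n%:R - 1) < M ->
    let u : 'I_n -> action n -> R := @utility R n M in
    let abar : worldview R n := barycenter R (ltnW hn) in
    let P : set (worldview R n) := @pure_worldviews R n in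
    let lc : R := lambda_c n M in
    0 < lc < 1 /\
    forall delta lambda : R, 0 < delta < 1 -> 0 < lambda < 1 ->
    [/\ exists phi z, stationary_MPE u delta lambda phi z,
        forall phi z, stationary_MPE u delta lambda phi z ->
          forall p, P p -> absorbing phi p,
        lambda < lc ->
          forall phi z, stationary_MPE u delta lambda phi z ->
            P (worldview_path phi abar 1) /\
            forall t, (1 <= t)%N ->
              worldview_path phi abar t = worldview_path phi abar 1,
        lc < lambda ->
          [/\ 0 < 2 / (1 + M),
              forall phi z, stationary_MPE u delta lambda phi z ->
                compromise_path M phi z abar,
              forall phi z, stationary_MPE u delta lambda phi z ->
                forall a0, trap_set M lambda a0 -> compromise_path M phi z a0,
              @trap_set R n M lambda !=set0 &
              open (@trap_set R n M lambda)] &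
        lambda = lc ->
          (exists phi z, stationary_MPE u delta lambda phi z /\
             exists p, absorbing_continuation phi abar p /\ P p) /\
          (exists phi z, stationary_MPE u delta lambda phi z /\
             exists p, absorbing_continuation phi abar p /\ ~ P p)]) /\
  lambda_c 3 (2 : R) = 1 / 2.
Proof.
split=> [n hn M HM u abar P lc|]; last by rewrite /lambda_c; field.
have M0 := M_gt0 hn HM; have lc01 := lambda_c_bounds hn HM.
split=> // delta lambda d01 l01.
pose i0 : 'I_n := Ordinal (ltnW hn).
have lc0 : 0 < lc by case/andP: lc01.
have gE i : pure_gain M lambda abar i = (lc - lambda) / lc.
  by apply: pure_gain_uniform => //; rewrite weight_barycenter.
(* The largest weight is always at least [1 / n], so the barycenter has the smallest favorite gain,
   which is nonnegative here. *)
have moving : lambda <= lc -> stationary_MPE u delta lambda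
    (fun a => vertex R (favorite i0 a)) (favorite_action M i0).
  move=> le; apply: moving_MPE => // a.
  have : 0 <= pure_gain M lambda abar i0 by rewrite gE divr_ge0 ?subr_ge0 // ltW.
  move/le_trans; apply; rewrite /pure_gain lerD2l lerN2 ler_wpM2l //.
    by rewrite mulr_ge0 ?addr_ge0 // ltW //; case/andP: l01.
  by rewrite lerD2l lerN2 weight_barycenter weight_favorite_ge.
have settling : lc <= lambda -> stationary_MPE u delta lambda
    (fun a => if 0 < pure_gain M lambda a (favorite i0 a)
              then vertex R (favorite i0 a) else abar) (favorite_action M i0).
  move=> le; apply: settling_MPE => //; first exact: barycenter_compromise.
  by rewrite gE pmulr_lle0 ?invr_gt0 // subr_le0.
split.
- case: (leP lambda lc) => [le|/ltW le].
    by do 2!eexists; exact: moving.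
  by do 2!eexists; exact: settling.
- by move=> phi z mpe _ [j _ <-]; exact: MPE_vertex_absorbing mpe.
- move=> lt phi z mpe.
  have [j _ e] : P (phi abar).
    apply: (MPE_moves_pure M0 d01 l01 (i := i0) mpe) => [|j].
      by rewrite gE divr_gt0 ?subr_gt0.
    by rewrite !gE.
  have pj := MPE_vertex_absorbing M0 d01 l01 j mpe.
  split=> [|[//|t] _]; first by exists j.
  by rewrite /worldview_path iterSr /= -e; elim: t => //= t ->.
- move=> lt.
  (* The barycenter itself is trapped, which settles both its path and nonemptiness. *)
  have trap : trap_set M lambda abar.
    apply/(trap_setP M0 l01 (ltnW hn)) => i.
    by rewrite gE pmulr_llt0 ?invr_gt0 // subr_lt0.
  split.
  + by rewrite divr_gt0 // addr_gt0.
  + by move=> phi z mpe; exact: MPE_trapped (ltnW hn) mpe trap.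
  + by move=> phi z mpe a0; exact: MPE_trapped (ltnW hn) mpe.
  + by exists abar.
  + exact: open_bigmax_weight.
(* At the critical value every gain at the barycenter vanishes and both constructions apply: one
   moves it to a vertex, the other, by its strict test, leaves it in place. *)
- move=> e; have gle : pure_gain M lambda abar (favorite i0 abar) = 0.
    by rewrite gE e subrr mul0r.
  split; do 2!eexists; split.
  + by apply: moving; rewrite e.
  + exists (vertex R (favorite i0 abar)); split; last exact: vertex_pure.
    by split=> //; rewrite /absorbing favorite_vertex.
  + by apply: settling; rewrite e.
  + exists abar; split; last exact: barycenter_not_pure.
    by split; rewrite /absorbing gle ltxx.
Qed.
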